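(* Let $\mathbb{K}$ be a field, let $0 \le \ell < k$ be integers, let $n \ge k$ be an integer, and let $X$ be a simplicial complex with $\Delta_{n-1}^{(k-1)} \subset X \subset \Delta_{n-1}^{(k)}$. Suppose that $\lambda_{\ell,k-\ell-2}(X)=\sum_{\tau \in X(\ell)} \tilde{\beta}_{k-\ell-2}(\mathrm{lk}(X,\tau))=0$. Then the following three conditions are equivalent: (a) $\tilde{\beta}_{k-1}(X)=B_{n,k,\ell}$; (b) $\tilde{\beta}_k(X)=0$ and $f_k(X)=F_{n,k,\ell}$; (c) $\mathrm{lk}(X,\tau)$ is a $(k-\ell-1)$-hypertree (over $\mathbb{K}$) on the vertex set $[n]-\tau$ for all $\tau\in\Delta_{n-1}(\ell)$. Here $$B_{n,k,\ell}=\frac{\binom{n-1}{\ell}\binom{n-\ell-2}{k-\ell}}{\binom{k+1}{\ell+1}},\qquad F_{n,k,\ell}=\binom{n-1}{k}-B_{n,k,\ell}=\frac{\binom{n}{\ell+1}\binom{n-\ell-2}{k-\ell-1}}{\binom{k+1}{\ell+1}}.$$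
   Context: Simplicial complexes are finite abstract simplicial complexes containing the empty simplex (of dimension $-1$). $\Delta(V)$ is the full simplex on the vertex set $V$, $\Delta_{n-1}=\Delta([n])$ with $[n]=\{0,\ldots,n-1\}$, and $Y^{(j)}$ denotes the $j$-dimensional skeleton of a complex $Y$. $X(j)$ is the set of $j$-dimensional simplices of $X$ and $f_j(X)=|X(j)|$. For $\tau\in X$, the link is $\mathrm{lk}(X,\tau)=\{\sigma\in X: \sigma\cup\tau\in X,\ \sigma\cap\tau=\emptyset\}$. $\tilde{\beta}_j(Y)=\dim_{\mathbb{K}}\tilde{H}_j(Y;\mathbb{K})$ is the reduced Betti number over the fixed field $\mathbb{K}$; in particular $\tilde\beta_{-1}(\{\emptyset\})=1$ and $\tilde\beta_{-1}(Y)=0$ if $Y$ has a vertex. $\subset$ allows equality. A complex $Y$ with $\Delta(V)^{(r-1)}\subset Y\subset\Delta(V)^{(r)}$ is an $r$-hypertree over $\mathbb{K}$ on the vertex set $V$ if $\tilde{H}_i(Y;\mathbb{K})=0$ for all $i$. Binomial coefficients are $\binom{a}{b}=a(a-1)\cdots(a-b+1)/b!$ for integers $a$ and $b \ge 0$. *)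

(* Defs.v *)
From HB Require Import structures.
From mathcomp Require Import all_boot all_order all_algebra.

Set Implicit Arguments.
Unset Strict Implicit.
Unset Printing Implicit Defensive.

Import Order.TTheory GRing.Theory Num.Theory.
Local Open Scope ring_scope.

(* Complexes with vertices among [n] are families of subsets of 'I_n; the     *)
(* actual vertex set is not recorded.  Dimensions are integers, the empty     *)
(* simplex having dimension -1.                                               *)

Section Complexes.
Variable n : nat.
Implicit Types (V s t : {set 'I_n}) (X Y : {set {set 'I_n}}) (j : int).

Definition is_complex X : bool :=
  (set0 \in X) && [forall s in X, powerset s \subset X].

Definition dimn s : int := #|s|%:Z - 1.

Definition full_simplex V : {set {set 'I_n}} := powerset V.

Definition skeleton j Y : {set {set 'I_n}} := [set s in Y | dimn s <= j].

Definition simplices X j : {set {set 'I_n}} := [set s in X | dimn s == j].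

Definition fnum X j : nat := #|simplices X j|.

Definition link X t : {set {set 'I_n}} :=
  [set s in X | (s :|: t \in X) && (s :&: t == set0)].

End Complexes.

Section Homology.
Variables (K : fieldType) (n : nat).
Implicit Types (V s t : {set 'I_n}) (Y : {set {set 'I_n}}) (j : int).

(* All chain groups live in the space with basis the simplices of Delta([n]). *)
Definition chain := {ffun {set 'I_n} -> K^o}.

Definition elem s : chain := [ffun t => (t == s)%:R].

(* Orientations come from the order of 'I_n: the sign exponent is the         *)
(* position of v in s.                                                        *)
Definition bdry_fun (c : chain) : chain :=
  \sum_(s : {set 'I_n}) c s *:
    \sum_(v in s) (-1) ^+ #|[set u in s | (u < v)%N]| *: elem (s :\ v).

Fact bdry_fun_is_linear : linear bdry_fun.
Proof.
move=> a c d; rewrite /bdry_fun scaler_sumr -big_split /=.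
by apply: eq_bigr => s _; rewrite !ffunE scalerDl scalerA.
Qed.

HB.instance Definition _ :=
  GRing.isLinear.Build K chain chain *:%R bdry_fun bdry_fun_is_linear.

Definition bdry : 'End(chain) := linfun bdry_fun.

Definition chains Y j : {vspace chain} :=
  <<[seq elem s | s <- enum (simplices Y j)]>>%VS.

Definition cycles Y j : {vspace chain} := (lker bdry :&: chains Y j)%VS.

Definition boundaries Y j : {vspace chain} := (bdry @: chains Y (j + 1))%VS.

(* The quotient of cycles by boundaries, realised as a complement of the      *)
(* boundaries inside the cycles.                                              *)
Definition homology Y j : {vspace chain} := (cycles Y j :\: boundaries Y j)%VS.

Definition betti Y j : nat := \dim (homology Y j).

Definition hypertree (r : int) V Y : Prop :=
  [/\ is_complex Y,
      skeleton (r - 1) (full_simplex V) \subset Y,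
      Y \subset skeleton r (full_simplex V)
    & forall i : int, homology Y i = 0%VS].

Definition lambda (l : nat) (j : int) Y : nat :=
  (\sum_(t in simplices Y l) betti (link Y t) j)%N.

End Homology.

(* The upper argument may be negative: n - l - 2 = -1 when n = k = l + 1.     *)
Definition binomz (a : int) (b : nat) : rat :=
  (\prod_(i < b) (a - i%:Z)%:~R) / (b`!)%:R.

Definition Bnum (n k l : nat) : rat :=
  binomz (n%:Z - 1) l * binomz (n%:Z - l%:Z - 2) (k - l)
    / binomz (k%:Z + 1) l.+1.

Definition Fnum (n k l : nat) : rat := binomz (n%:Z - 1) k - Bnum n k l.

(* Main.v *)
From HB Require Import structures.
Require Import Defs.
From mathcomp Require Import all_boot all_order all_algebra.
From mathcomp Require Import ring lra zify.

(* Write L for the sum of the top Betti numbers of the links of the            *)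
(* l-simplices, and C for 'C(k+1, l+1).  Euler characteristics of X and of     *)
(* the links, with a double count of the pairs (l-simplex in k-simplex), give  *)
(*   f_k(X) = F + L / C  and  b_(k-1)(X) = b_k(X) + B - L / C.                 *)
(* Condition (c) says that L = 0, so everything follows once C * b_k(X) < L    *)
(* whenever b_k(X) <> 0.  For this, take a basis of the k-cycles of X dual to  *)
(* evaluation at the simplices of a set E.  Localising the basic cycles of the *)
(* e in E containing an l-simplex t gives independent cycles in the link of t; *)
(* summing over t yields C * #|E| = C * b_k(X) of them.  The basic cycle of e  *)
(* has another face s, and localising it at some t inside s but not inside e   *)
(* gives one more independent cycle.                                           *)

Set Implicit Arguments.
Unset Strict Implicit.
Unset Printing Implicit Defensive.

Import Order.TTheory GRing.Theory Num.Theory.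
Local Open Scope ring_scope.

(** With L and C as above and r = k - l - 1, the two counting formulas come from
    [euler_nearly_full], applied to X and to each link, and from [sum_fnum_link]; the vanishing
    hypothesis removes the Betti number in dimension r - 1 from the Euler relation of a link. The
    strict bound is [betti_lt_lambda]. It needs localisation of cycles, which works because the
    boundary is a sum of anticommuting contractions, and independence of cycles, which is read off
    supports through [dual_system]. Each condition then amounts to L = 0: (a) says C * b_k = L,
    which the strict bound allows only if both sides vanish; (b) gives L = 0 through f_k; (c) says
    that every summand of L vanishes. Conversely L = 0 forces b_k = 0, and both counts follow. *)

(** * Binomial coefficients with an integer upper argument *)

Lemma binomz_nat (m b : nat) : binomz m%:Z b = 'C(m, b)%:R.
Proof.
rewrite /binomz; apply: (canLR (mulfK _)); first by rewrite pnatr_eq0 -lt0n fact_gt0.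
rewrite -natrM bin_ffact; elim: b => [|b IH]; first by rewrite big_ord0 ffactn0.
rewrite big_ord_recr /= IH ffactnSr natrM.
have [hb|hb] := leqP b m; first by rewrite intrB -natrB.
by rewrite ffact_small // !mul0r.
Qed.

(** This equates the two expressions for F, denominators cleared. With d = k - l - 1, the three
    products in n share the factors [P] and [Q]; what remains is (n-l-1)(l+d+2) = (l+1)(n-l-2-d) +
    n(d+1), a polynomial identity, hence valid also when n - l - 2 is negative. *)
Lemma binomz_Bnum_Fnum (n k l : nat) : (l < k)%N ->
  binomz (n%:Z - 1) k * binomz (k%:Z + 1) l.+1 =
  binomz (n%:Z - 1) l * binomz (n%:Z - l%:Z - 2) (k - l) +
  binomz n%:Z l.+1 * binomz (n%:Z - l%:Z - 2) (k - l - 1).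
Proof.
move=> hlk; have [d ->] : exists d, k = (l.+1 + d)%N by exists (k - l.+1)%N; lia.
have -> : (l.+1 + d - l = d.+1)%N by lia.
have -> : (d.+1 - 1 = d)%N by lia.
have -> : (l.+1 + d)%:Z + 1 = (l.+1 + d.+1)%N%:Z :> int by lia.
rewrite binomz_nat.
have -> : 'C(l.+1 + d.+1, l.+1)%:R =
    ((l.+1 + d.+1)`!)%:R / ((l.+1)`!%:R * (d.+1)`!%:R) :> rat.
  apply: (canRL (mulfK _)).
    by rewrite -natrM pnatr_eq0 -lt0n muln_gt0 !fact_gt0.
  by rewrite -!natrM -(@bin_fact (l.+1 + d.+1) l.+1) ?leq_addr // addKn.
rewrite /binomz big_split_ord /= big_ord_recr /=.
rewrite [X in _ = _ * (X / _) + _]big_ord_recr /=.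
rewrite [X in _ = _ + (X / _) * _]big_ord_recl /=.
set P := \prod_(i < l) (n%:Z - 1 - i%:Z)%:~R.
have -> : \prod_(i < l) (n%:Z - (bump 0 i)%:Z)%:~R = P :> rat.
  by apply: eq_bigr => i _; congr _%:~R; rewrite /bump /=; lia.
set Q := \prod_(i < d) (n%:Z - l%:Z - 2 - i%:Z)%:~R.
have -> : \prod_(i < d) (n%:Z - 1 - (l.+1 + i)%:Z)%:~R = Q :> rat.
  by apply: eq_bigr => i _; congr _%:~R; lia.
have Efact : ((l.+1 + d.+1)`!)%:R = (l%:R + d%:R + 2) * ((l.+1 + d)`!)%:R :> rat.
  rewrite addnS factS natrM; congr (_ * _).
  by rewrite -(natrD _ l) -natrD; congr _%:R; lia.
have Efl : (l.+1`!)%:R = (l%:R + 1) * (l`!)%:R :> rat by rewrite factS natrM -natr1.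
have Efd : (d.+1`!)%:R = (d%:R + 1) * (d`!)%:R :> rat by rewrite factS natrM -natr1.
rewrite Efact Efl Efd !intrB.
have nz (m : nat) : (m`!)%:R != 0 :> rat by rewrite pnatr_eq0 -lt0n fact_gt0.
have nzS (m : nat) : m%:R + 1 != 0 :> rat by rewrite natr1 pnatr_eq0.
rewrite -[n%:~R]/(n%:R) -[l%:~R]/(l%:R) -[d%:~R]/(d%:R).
by field; rewrite !nz !nzS.
Qed.

(** * Interior and exterior multiplication by a vertex, and the boundary *)

Section Contraction.
Variables (K : fieldType) (n : nat).
Implicit Types (u v w : 'I_n) (s t : {set 'I_n}) (c : chain K n).

Definition pos v t : nat := #|[set u in t | (u < v)%N]|.

(** Interior product with [v]: the part of the boundary that comes from deleting [v]. *)
Definition contract v c : chain K n :=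
  [ffun t : {set 'I_n} => if v \in t then 0 else (-1) ^+ pos v t * c (v |: t)].

(** Exterior product with [v], the cone with apex [v]. *)
Definition cone v c : chain K n :=
  [ffun t : {set 'I_n} => if v \in t then (-1) ^+ pos v t * c (t :\ v) else 0].

Lemma posU1 u v t : u \notin t -> pos v (u |: t) = ((u < v) + pos v t)%N.
Proof.
move=> ut; rewrite /pos; have [uv|uv] := boolP (u < v)%N.
  have -> : [set x in u |: t | (x < v)%N] = u |: [set x in t | (x < v)%N].
    by apply/setP=> x; rewrite !inE; case: eqVneq => //= ->; rewrite uv.
  by rewrite cardsU1 inE (negPf ut).
congr #|pred_of_set _|; apply/setP=> x; rewrite !inE.
by case: eqVneq => //= ->; rewrite (negPf uv) andbF.
Qed.

(** For distinct vertices exactly one of u < v and v < u holds, so swapping the order of removal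
    changes exactly one position by one. *)
Lemma contract_anticomm u v c :
  contract u (contract v c) = - contract v (contract u c).
Proof.
apply/ffunP=> t; rewrite !ffunE !inE.
have [<-|uv] /= := eqVneq u v.
  by case: (u \in t); rewrite /= ?eqxx ?mulr0 oppr0.
have [ut|ut] := boolP (u \in t); have [vt|vt] := boolP (v \in t); rewrite ?mulr0 ?oppr0 //.
rewrite (posU1 _ ut) (posU1 _ vt) setUCA !exprD.
have : (u < v)%N + (v < u)%N = 1%N :> nat.
  by move: uv; rewrite -val_eqE /=; case: ltngtP.
case: (u < v)%N; case: (v < u)%N => //= _; ring.
Qed.

Lemma bdryE c : bdry K n c = \sum_v contract v c.
Proof.
rewrite lfunE /= /bdry_fun; apply/ffunP=> t; rewrite !sum_ffunE.
under eq_bigr => s _ do rewrite ffunE sum_ffunE scaler_sumr.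
rewrite (exchange_big_dep predT) //=; apply: eq_bigr => v _; rewrite ffunE.
have [vt|vt] := boolP (v \in t).
  apply: big1 => s vs; rewrite !ffunE; case: eqP => [E|_]; last by rewrite !scaler0.
  by move: vt; rewrite E !inE eqxx.
rewrite (bigD1 (v |: t)) ?setU11 //= big1 ?addr0 => [|s /andP[vs st]]; last first.
  rewrite !ffunE; case: eqP => [E|_]; last by rewrite !scaler0.
  by case/eqP: st; rewrite E setD1K.
rewrite !ffunE setU1K // eqxx -[#|_|]/(pos v (v |: t)) posU1 // ltnn /= add0n.
by rewrite /GRing.scale /= mulr1 mulrC.
Qed.

Lemma contract_is_linear v : linear (contract v).
Proof.
move=> a c d; apply/ffunP=> t; rewrite !ffunE; case: ifP => _.
  by rewrite /GRing.scale /= mulr0 addr0.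
by rewrite /GRing.scale /=; ring.
Qed.

HB.instance Definition _ v :=
  GRing.isLinear.Build K (chain K n) (chain K n) *:%R (contract v)
    (contract_is_linear v).

Lemma cone_is_linear v : linear (cone v).
Proof.
move=> a c d; apply/ffunP=> t; rewrite !ffunE; case: ifP => _.
  by rewrite /GRing.scale /=; ring.
by rewrite /GRing.scale /= mulr0 addr0.
Qed.

HB.instance Definition _ v :=
  GRing.isLinear.Build K (chain K n) (chain K n) *:%R (cone v) (cone_is_linear v).

Lemma contractK v c : contract v (contract v c) = 0.
Proof. by apply/ffunP=> t; rewrite !ffunE setU11; case: ifP; rewrite ?mulr0. Qed.

Lemma bdry_contract v c : bdry K n (contract v c) = - contract v (bdry K n c).
Proof.
rewrite !bdryE linear_sum -sumrN; apply: eq_bigr => u _.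
by rewrite contract_anticomm.
Qed.

(* In the sum of all [contract u (contract v c)] the terms with [u < v] cancel *)
(* those with [v < u]; this avoids dividing by 2.                              *)
Lemma bdryK c : bdry K n (bdry K n c) = 0.
Proof.
rewrite !bdryE; under eq_bigr => u _ do rewrite linear_sum /=.
have split u : \sum_(v : 'I_n) contract u (contract v c) =
    \sum_(v : 'I_n | (u < v)%N) contract u (contract v c) +
    \sum_(v : 'I_n | (v < u)%N) contract u (contract v c).
  rewrite (bigD1 u) //= contractK add0r (bigID (fun v : 'I_n => u < v)%N) /=.
  by congr (_ + _); apply: eq_bigl => v; rewrite -val_eqE /=; case: ltngtP.
under eq_bigr => u _ do rewrite split.
rewrite big_split /= [X in _ + X](exchange_big_dep predT) //= -big_split /=.
apply: big1 => u _; apply/eqP; rewrite addr_eq0 -sumrN; apply/eqP.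
by apply: eq_bigr => v _; rewrite contract_anticomm.
Qed.

(** The Clifford relation between interior and exterior products; summed over u it makes [cone v] a
    contracting homotopy ([bdry_cone]). *)
Lemma contract_cone u v c :
  contract u (cone v c) + cone v (contract u c) = (u == v)%:R *: c.
Proof.
apply/ffunP=> t; rewrite !ffunE !inE.
have [<-|uv] /= := eqVneq u v.
  rewrite scale1r ?eqxx /=; have [ut|ut] := boolP (u \in t).
    rewrite setD1K // add0r mulrA -exprD.
    have -> : pos u (t :\ u) = pos u t.
      by rewrite -{2}(setD1K ut) posU1 ?ltnn // !inE eqxx.
    by rewrite addnn -signr_odd odd_double mul1r.
  by rewrite setU1K // posU1 // ltnn addr0 mulrA -exprD addnn -signr_odd odd_double mul1r.
rewrite scale0r /=.
have [ut|ut] := boolP (u \in t); have [vt|vt] := boolP (v \in t); rewrite ?mulr0 ?addr0 //.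
have Es : (u |: t) :\ v = u |: (t :\ v).
  apply/setP=> x; rewrite !inE; case: (eqVneq x u) => [->|]; by rewrite ?uv.
have -> : pos u t = ((v < u) + pos u (t :\ v))%N.
  by rewrite -{1}(setD1K vt) posU1 // !inE eqxx.
rewrite Es (posU1 _ ut) !exprD.
have : (u < v)%N + (v < u)%N = 1%N :> nat.
  by move: uv; rewrite -val_eqE /=; case: ltngtP.
case: (u < v)%N; case: (v < u)%N => //= _; ring.
Qed.

Lemma bdry_cone v c : bdry K n (cone v c) + cone v (bdry K n c) = c.
Proof.
rewrite !bdryE linear_sum -big_split /= (bigD1 v) //= contract_cone eqxx scale1r.
by rewrite big1 ?addr0 // => u uv; rewrite contract_cone (negPf uv) scale0r.
Qed.

(* Iterating contractions localises a chain at [t] without an explicit sign    *)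
(* for the order of the vertices of [t] relative to those of [s].              *)
Definition contract_set t c : chain K n := foldr contract c (enum t).

Lemma bdry_contract_set t c :
  bdry K n c = 0 -> bdry K n (contract_set t c) = 0.
Proof.
rewrite /contract_set => c0; elim: (enum t) => //= v r IH.
by rewrite bdry_contract IH linear0 oppr0.
Qed.

Lemma contract_set_eq0 t c s :
  (contract_set t c s == 0) = (s :&: t != set0) || (c (s :|: t) == 0).
Proof.
have E : t = [set x in enum t] by apply/setP=> x; rewrite inE mem_enum.
rewrite /contract_set {2 3}E; have := enum_uniq (mem t).
elim: (enum t) s => [|v r IH] s /=.
  have -> : [set x in [::]] = set0 :> {set 'I_n} by apply/setP.
  by rewrite setI0 eqxx setU0.
case/andP=> vr ur; rewrite ffunE set_cons.
have [vs|vs] := boolP (v \in s).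
  by rewrite eqxx; apply/esym/orP; left; apply/set0Pn; exists v; rewrite !inE vs eqxx.
rewrite mulf_eq0 signr_eq0 /= IH //; congr (~~ (_ == _) || (c _ == 0)).
  apply/setP=> x; rewrite !inE; case: (eqVneq x v) => //= ->.
  by rewrite (negPf vs) (negPf vr).
by rewrite setUCA setUA.
Qed.

End Contraction.

(** * Independence detected by evaluation at coordinates *)

Section DualCoordinates.
Variables (K : fieldType) (I : finType).
Local Notation vT := {ffun I -> K^o}.
Implicit Types (U : {vspace vT}) (E : {set I}).

Definition coordinate (i : I) (u : vT) : K^o := u i.

Fact coordinate_is_linear i : linear (coordinate i).
Proof. by move=> a u v; rewrite /coordinate !ffunE. Qed.

HB.instance Definition _ i :=
  GRing.isLinear.Build K vT K^o *:%R (coordinate i) (coordinate_is_linear i).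

Definition hyperplane i : {vspace vT} := lker (linfun (coordinate i)).

Lemma mem_hyperplane i (u : vT) : (u \in hyperplane i) = (u i == 0).
Proof. by rewrite memv_ker lfunE. Qed.

Lemma dim_cap_hyperplane i U : (\dim U <= (\dim (U :&: hyperplane i)).+1)%N.
Proof.
rewrite -(limg_ker_dim (linfun (coordinate i)) U) -addn1 leq_add2l.
by rewrite (leq_trans (dimvS (subvf _))) // dimvf.
Qed.

Lemma dim_cap_hyperplane_lt i U (u : vT) :
  u \in U -> u i != 0 -> (\dim (U :&: hyperplane i) < \dim U)%N.
Proof.
move=> uU ui; rewrite ltn_neqAle (dimv_leqif_eq (capvSl _ _)) dimvS ?capvSl // andbT.
apply: contra ui => /eqP E; rewrite -mem_hyperplane.
by move: uU; rewrite -{1}E memv_cap => /andP[].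
Qed.

(** Vectors of U dual to the evaluations at E up to nonzero scalars. Fixing only the pattern of
    zeros makes the notion insensitive to the signs of contractions. *)
Definition dual_system U E :=
  forall i, i \in E -> exists2 u : vT, u \in U &
    forall j, j \in E -> (u j != 0) = (j == i).

Lemma dual_systemD1 U E i : i \in E -> dual_system U E ->
  dual_system (U :&: hyperplane i) (E :\ i).
Proof.
move=> iE dE j /setD1P[ji jE]; have [u uU uE] := dE _ jE.
exists u => [|h /setD1P[_ /uE //]].
by rewrite memv_cap uU mem_hyperplane -[_ == 0]negbK uE // eq_sym.
Qed.

(** Intersecting U with the hyperplane of one i in E loses the vector of i, hence at least one
    dimension, and keeps the other vectors. *)
Lemma card_dual_system U E : dual_system U E -> (#|E| <= \dim U)%N.
Proof.
have [m] := ubnP #|E|; elim: m U E => // m IH U E ltEm dE.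
have [->|[i iE]] := set_0Vmem E; first by rewrite cards0.
have [u uU uE] := dE _ iE; rewrite (cardsD1 i E) iE add1n in ltEm *.
apply: leq_ltn_trans (IH _ _ _ (dual_systemD1 iE dE)) _ => //.
by apply: dim_cap_hyperplane_lt uU _; rewrite uE.
Qed.

(** The vector w survives all the cuts by hyperplanes, so a nonzero space is left at the end. *)
Lemma card_dual_system_lt U E (w : vT) : dual_system U E ->
  w \in U -> w != 0 -> (forall i, i \in E -> w i = 0) -> (#|E| < \dim U)%N.
Proof.
have [m] := ubnP #|E|; elim: m U E => // m IH U E ltEm dE wU w0 wE.
have [->|[i iE]] := set_0Vmem E.
  rewrite cards0 lt0n dimv_eq0; apply: contra w0 => /eqP U0.
  by rewrite U0 memv0 in wU.
have [u uU uE] := dE _ iE; rewrite (cardsD1 i E) iE add1n in ltEm *.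
apply: leq_ltn_trans (IH _ _ _ (dual_systemD1 iE dE) _ w0 _) _ => //.
- by rewrite memv_cap wU mem_hyperplane wE ?eqxx.
- by move=> j /setD1P[_ /wE].
- by apply: dim_cap_hyperplane_lt uU _; rewrite uE.
Qed.

Lemma exists_vanishing U E : (#|E| < \dim U)%N ->
  exists2 w : vT, w \in U /\ w != 0 & forall i, i \in E -> w i = 0.
Proof.
have [m] := ubnP #|E|; elim: m U E => // m IH U E ltEm ltEU.
have [E0|[i iE]] := set_0Vmem E.
  exists (vpick U); last by move=> i; rewrite E0 inE.
  by split; rewrite ?memv_pick // vpick0 -dimv_eq0 -lt0n (leq_ltn_trans _ ltEU).
rewrite (cardsD1 i E) iE add1n in ltEm ltEU.
have [||w [wU w0] wE] := IH (U :&: hyperplane i)%VS (E :\ i) => //.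
  by rewrite -ltnS (leq_trans ltEU) // dim_cap_hyperplane.
move: wU; rewrite memv_cap mem_hyperplane => /andP[wU /eqP wi].
by exists w => // j jE; have [->//|ji] := eqVneq j i; apply: wE; rewrite !inE ji.
Qed.

(** Greedy elimination: while E is smaller than the dimension, some nonzero w in U vanishes on E;
    any coordinate i with w i nonzero joins E. *)
Lemma exists_dual_system U : exists2 E, dual_system U E & #|E| = \dim U.
Proof.
suff H m : (m <= \dim U)%N -> exists2 E, dual_system U E & #|E| = m by exact: H.
elim: m => [|m IH] lemU; first by exists set0; rewrite ?cards0 // => i; rewrite inE.
have [E dE Em] := IH (ltnW lemU).
have [|w [wU w0] wE] := @exists_vanishing U E; first by rewrite Em.
have [i wi] : exists i, w i != 0.
  by apply/existsP; apply: contraR w0 => /existsPn w0; apply/eqP/ffunP=> i;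
     rewrite ffunE; apply/eqP/negPn/w0.
have iE : i \notin E by apply: contra wi => /wE ->.
exists (i |: E); last by rewrite cardsU1 iE Em.
move=> j /setU1P[->|jE].
  exists w => // h /setU1P[->|hE]; first by rewrite eqxx.
  rewrite wE // eqxx; apply/esym/negbTE; apply: contraNneq iE => <- //.
(* The correction cancels the new coordinate i and leaves those in E unchanged, as w is zero
   there. *)
have [u uU uE] := dE _ jE; exists (u - (u i / w i) *: w).
  by rewrite memvB // memvZ.
move=> h /setU1P[->|hE]; rewrite !ffunE /GRing.scale /=.
  rewrite divfK // subrr eqxx; apply/esym/negbTE.
  by apply: contraNneq iE => ->.
by rewrite (wE h) // mulr0 subr0 uE.
Qed.

End DualCoordinates.

(** * Chains, cycles and Betti numbers; complexes between two consecutive skeleta *)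

Section Complexes.
Variables (K : fieldType) (n : nat).
Implicit Types (v w : 'I_n) (s t W : {set 'I_n}) (X Y : {set {set 'I_n}}).
Implicit Types (c : chain K n) (j : int).

Lemma complexS X s t : is_complex X -> s \in X -> t \subset s -> t \in X.
Proof.
case/andP=> _ /forallP/(_ s)/implyP H sX ts; apply: (subsetP (H sX)).
by rewrite powersetE.
Qed.

Lemma is_complex_full W : is_complex (full_simplex W).
Proof.
rewrite /is_complex powersetE sub0set; apply/forall_inP=> s; rewrite powersetE => sW.
by rewrite powersetS.
Qed.

Lemma mem_chains Y j c :
  reflect (forall s, c s != 0 -> s \in simplices Y j) (c \in chains K Y j).
Proof.
apply: (iffP idP) => [cY s|cY].
  apply: contraR => sY; rewrite -(mem_hyperplane s c); move: cY; apply/subvP.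
  apply/span_subvP=> _ /mapP[t tY ->]; rewrite mem_hyperplane ffunE.
  by rewrite mem_enum in tY; rewrite (negPf (_ : s != t)) //; apply: contraNneq sY => ->.
have -> : c = \sum_(s in simplices Y j) c s *: elem K s.
  apply/ffunP=> t; rewrite sum_ffunE.
  have [tY|tY] := boolP (t \in simplices Y j).
    rewrite (bigD1 t) //= big1 ?addr0 => [|s /andP[_ st]].
      by rewrite !ffunE eqxx /GRing.scale /= mulr1.
    by rewrite !ffunE eq_sym (negPf st) scaler0.
  rewrite big1 => [|s sY]; first by apply/eqP; apply: contraR tY => /cY.
  by rewrite !ffunE (negPf (_ : t != s)) ?scaler0 //; apply: contraNneq tY => ->.
apply: memv_suml => s sY; apply: memvZ; apply: memv_span.
by apply: map_f; rewrite mem_enum.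
Qed.

Lemma mem_cycles Y j c :
  (c \in cycles K Y j) = (bdry K n c == 0) && (c \in chains K Y j).
Proof. by rewrite memv_cap memv_ker. Qed.

Lemma dim_chains Y j : \dim (chains K Y j) = fnum Y j.
Proof.
apply/eqP; rewrite eqn_leq; apply/andP; split.
  by rewrite (leq_trans (dim_span _)) // size_map -cardE.
apply: card_dual_system => s sY; exists (elem K s).
  by apply: memv_span; apply: map_f; rewrite mem_enum.
by move=> t _; rewrite ffunE; have [_|_] := eqVneq t s; rewrite ?oner_eq0 ?eqxx.
Qed.

Lemma dim_cycles_boundaries Y j :
  (\dim (cycles K Y j) + \dim (boundaries K Y (j - 1)) = fnum Y j)%N.
Proof. by rewrite /cycles /boundaries subrK capvC limg_ker_dim dim_chains. Qed.

Lemma dimnU1 v s j : v \notin s -> (dimn (v |: s) == j + 1) = (dimn s == j).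
Proof. by rewrite /dimn cardsU1 => ->; move: #|s| => m; lia. Qed.

Lemma contract_chains Y j v c : is_complex Y ->
  c \in chains K Y (j + 1) -> contract v c \in chains K Y j.
Proof.
move=> hY /mem_chains cY; apply/mem_chains=> s; rewrite ffunE.
have [|vs] := boolP (v \in s); rewrite ?eqxx // mulf_eq0 signr_eq0 => /cY.
rewrite !inE dimnU1 // => /andP[vsY ->].
by rewrite (complexS hY vsY (subsetUr _ _)).
Qed.

Lemma boundaries_sub_cycles Y j : is_complex Y ->
  (boundaries K Y j <= cycles K Y j)%VS.
Proof.
move=> hY; apply/subvP=> _ /memv_imgP[c cY ->]; rewrite mem_cycles bdryK eqxx /=.
by rewrite bdryE; apply: memv_suml => v _; apply: contract_chains.
Qed.

Lemma dim_betti_boundaries Y j : is_complex Y ->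
  (betti K Y j + \dim (boundaries K Y j) = \dim (cycles K Y j))%N.
Proof.
move=> hY; rewrite addnC -(dimv_cap_compl (cycles K Y j) (boundaries K Y j)).
by rewrite (capv_idPr (boundaries_sub_cycles _ hY)).
Qed.

Lemma chains_eq0 Y j : simplices Y j = set0 -> chains K Y j = 0%VS.
Proof. by move=> Y0; apply/eqP; rewrite -dimv_eq0 dim_chains /fnum Y0 cards0. Qed.

Lemma eq_cycles Y Y' j : simplices Y j = simplices Y' j ->
  cycles K Y j = cycles K Y' j.
Proof. by rewrite /cycles /chains => ->. Qed.

Lemma eq_boundaries Y Y' j : simplices Y (j + 1) = simplices Y' (j + 1) ->
  boundaries K Y j = boundaries K Y' j.
Proof. by rewrite /boundaries /chains => ->. Qed.

Lemma simplices_neg Y j : j < -1 -> simplices Y j = set0.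
Proof.
by move=> j1; apply/setP=> s; rewrite !inE /dimn; apply/negbTE; apply/nandP; right; lia.
Qed.

(** A nonempty simplex is acyclic: the cone over a cycle with apex in W bounds it. *)
Lemma boundaries_full W j : W != set0 ->
  boundaries K (full_simplex W) j = cycles K (full_simplex W) j.
Proof.
case/set0Pn=> w wW; apply/eqP; rewrite eqEsubv boundaries_sub_cycles ?is_complex_full //=.
apply/subvP=> c; rewrite mem_cycles => /andP[/eqP c0 /mem_chains cW].
rewrite -(bdry_cone w c) c0 linear0 addr0; apply: memv_img; apply/mem_chains=> s.
rewrite ffunE; have [ws|] := boolP (w \in s); rewrite ?eqxx //.
rewrite mulf_eq0 signr_eq0 => /cW; rewrite !inE subDset (setUidPr _) ?sub1set //.
by rewrite -(dimnU1 (v := w)) ?setD1K // !inE eqxx.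
Qed.

Lemma fnum_full W (p : nat) : fnum (full_simplex W) (p%:Z - 1) = 'C(#|W|, p).
Proof.
rewrite -cards_draws; congr #|pred_of_set _|; apply/setP=> s; rewrite !inE /dimn.
by congr (_ && _); apply/eqP/eqP; lia.
Qed.

(** By acyclicity rank-nullity becomes Pascal's rule; p counts vertices, so the induction starts in
    dimension -1. *)
Lemma dim_cycles_full W (p : nat) : W != set0 ->
  \dim (cycles K (full_simplex W) (p%:Z - 1)) = 'C(#|W|.-1, p).
Proof.
move=> W0; have := W0; rewrite -card_gt0; case E: #|W| => [//|m] _ /=.
elim: p => [|p IH].
  have := dim_cycles_boundaries (full_simplex W) (0%:Z - 1).
  rewrite fnum_full boundaries_full //.
  rewrite {2}/cycles chains_eq0 ?simplices_neg // capv0 dimv0 addn0 => ->.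
  by rewrite !bin0.
have := dim_cycles_boundaries (full_simplex W) (p.+1%:Z - 1).
rewrite fnum_full boundaries_full // E binS.
have -> : p.+1%:Z - 1 - 1 = p%:Z - 1 :> int by lia.
by rewrite IH; lia.
Qed.

Section NearlyFull.
Variables (W : {set 'I_n}) (Y : {set {set 'I_n}}) (r : nat).
Hypotheses (hY : is_complex Y) (leY : skeleton (r%:Z - 1) (full_simplex W) \subset Y).
Hypothesis geY : Y \subset skeleton r%:Z (full_simplex W).

Lemma simplices_nearly_full j : j < r%:Z -> simplices Y j = simplices (full_simplex W) j.
Proof.
move=> jr; apply/setP=> s; rewrite !inE; have [dj|] := eqVneq (dimn s) j; rewrite ?andbF ?andbT //.
apply/idP/idP=> sY; first by have := subsetP geY _ sY; rewrite !inE => /andP[].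
by apply: (subsetP leY); rewrite !inE sY dj lerBrDr lezD1.
Qed.

Lemma simplices_above j : r%:Z < j -> simplices Y j = set0.
Proof.
move=> rj; apply/setP=> s; rewrite !inE; apply/negbTE/negP=> /andP[sY /eqP dj].
by have := subsetP geY _ sY; rewrite !inE dj leNgt rj andbF.
Qed.

Lemma bettiE_top : betti K Y r%:Z = \dim (cycles K Y r%:Z).
Proof.
rewrite -(dim_betti_boundaries r%:Z hY) /boundaries chains_eq0.
  by rewrite limg0 dimv0 addn0.
by rewrite simplices_above // ltrDl.
Qed.

(** The cycles in dimension r - 1 are those of the full simplex, so their dimension is known;
    computing it also from [boundaries K Y (r - 1)], whose rank comes from the r-simplices, gives
    the relation. *)
Lemma euler_nearly_full : (r <= #|W|)%N ->
  (betti K Y r%:Z)%:R + binomz (#|W|%:Z - 1) r =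
  (fnum Y r%:Z)%:R + (betti K Y (r%:Z - 1))%:R.
Proof.
move=> rW; have E1 := dim_betti_boundaries (r%:Z - 1) hY.
have E2 := dim_cycles_boundaries Y r%:Z; rewrite -bettiE_top in E2.
have -> : binomz (#|W|%:Z - 1) r = (\dim (cycles K Y (r%:Z - 1)))%:R.
  have -> : cycles K Y (r%:Z - 1) = cycles K (full_simplex W) (r%:Z - 1).
    by apply/eq_cycles/simplices_nearly_full; lia.
  have [W0|W0] := eqVneq W set0; last first.
    rewrite dim_cycles_full // -binomz_nat.
    by have := W0; rewrite -card_gt0 => ?; congr binomz; lia.
  (* An empty W forces r = 0, where both sides are 1: an empty product, and the one empty
     simplex. *)
  rewrite W0 cards0 in rW *; have -> : r = 0%N by lia.
  rewrite /binomz big_ord0 fact0 divr1 -[LHS]/(1%:R); congr _%:R.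
  have := dim_cycles_boundaries (full_simplex (set0 : {set 'I_n})) (0%:Z - 1).
  rewrite fnum_full cards0 bin0.
  have -> : \dim (boundaries K (full_simplex (set0 : {set 'I_n})) (0%:Z - 1 - 1)) = 0%N.
    apply/eqP; rewrite dimv_eq0 -subv0.
    rewrite (subv_trans (boundaries_sub_cycles _ (is_complex_full _))) //.
    by rewrite /cycles chains_eq0 ?capv0 ?subvv ?simplices_neg.
  by rewrite addn0 => ->.
by rewrite -!natrD; congr _%:R; lia.
Qed.

(** Below dimension r - 1 the homology is that of the full simplex; such dimensions from -1 on exist
    only if r > 0, and then W is nonempty. *)
Lemma hypertree_nearly_full : (0 < r -> W != set0)%N ->
  hypertree K r%:Z W Y <-> betti K Y (r%:Z - 1) = 0%N /\ betti K Y r%:Z = 0%N.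
Proof.
move=> W0; split=> [[_ _ _ H]|[b1 b2]]; first by rewrite /betti !H dimv0.
split=> // i; have [i1|i1] := boolP (i < -1).
  by apply/eqP; rewrite diffv_eq0 /cycles chains_eq0 ?capv0 ?sub0v ?simplices_neg.
have [ir|ir|ir] := ltgtP i r%:Z; last by apply/eqP; rewrite ir -dimv_eq0 -/(betti K Y r%:Z) b2.
  have [->|ir1] := eqVneq i (r%:Z - 1).
    by apply/eqP; rewrite -dimv_eq0 -/(betti K Y (r%:Z - 1)) b1.
  have W1 : W != set0 by apply: W0; lia.
  apply/eqP; rewrite diffv_eq0 (eq_cycles (simplices_nearly_full ir)).
  rewrite (eq_boundaries (simplices_nearly_full _)); last by lia.
  by rewrite boundaries_full.
by apply/eqP; rewrite diffv_eq0 /cycles chains_eq0 ?capv0 ?sub0v ?simplices_above.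
Qed.

End NearlyFull.

End Complexes.

(** * Links of l-simplices, double counting and localised cycles *)

Section Links.
Variables (K : fieldType) (n : nat).
Implicit Types (s t : {set 'I_n}) (X Y E : {set {set 'I_n}}).

Lemma dimn_eq s (m : nat) : (dimn s == m%:Z) = (#|s| == m.+1).
Proof. by rewrite /dimn; move: #|s| => p; lia. Qed.

Lemma dimn_le s (m : nat) : (dimn s <= m%:Z) = (#|s| <= m.+1)%N.
Proof. by rewrite /dimn; move: #|s| => p; lia. Qed.

Lemma mem_link X s t : is_complex X ->
  (s \in link X t) = (s :|: t \in X) && (s :&: t == set0).
Proof.
move=> hX; rewrite inE; have [stX|] := boolP (s :|: t \in X); rewrite ?andbF //=.
by rewrite (complexS hX stX (subsetUl _ _)).
Qed.

Lemma is_complex_link X t : is_complex X -> t \in X -> is_complex (link X t).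
Proof.
move=> hX tX; rewrite /is_complex mem_link // set0U tX set0I eqxx /=.
apply/forall_inP=> s; rewrite mem_link // => /andP[stX /eqP st0].
apply/subsetP=> s'; rewrite powersetE => s's; rewrite mem_link //.
rewrite (complexS hX stX) ?setSU //=.
by rewrite -subset0 -st0 setSI.
Qed.

Lemma cardsUI0 s t : s :&: t == set0 -> #|s :|: t| = (#|s| + #|t|)%N.
Proof. by move/eqP=> st; rewrite cardsU st cards0 subn0. Qed.

Lemma exists_subset_card s (m : nat) : (m <= #|s|)%N ->
  exists2 t : {set _}, t \subset s & #|t| = m.
Proof.
rewrite -bin_gt0 -cards_draws card_gt0 => /set0Pn[t]; rewrite inE.
by case/andP=> ts /eqP; exists t.
Qed.

Section Flags.
Variables (k l : nat) (X : {set {set 'I_n}}).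
Hypotheses (hlk : (l < k)%N) (hX : is_complex X).
Local Notation r := (k - l - 1)%N.

Lemma mem_simplices s (m : nat) : (s \in simplices X m%:Z) = (s \in X) && (#|s| == m.+1).
Proof. by rewrite inE dimn_eq. Qed.

(** Double counting: each k-simplex has 'C(k+1, l+1) faces of dimension l. *)
Lemma sum_card_supersets E : E \subset simplices X k%:Z ->
  (\sum_(t in simplices X l%:Z) #|[set s in E | t \subset s]| =
   'C(k.+1, l.+1) * #|E|)%N.
Proof.
move=> EX; under eq_bigr => t _ do rewrite -sum1_card.
rewrite (exchange_big_dep (mem E)) /= => [|t s _]; last by rewrite inE => /andP[].
rewrite mulnC -sum_nat_const; apply: eq_bigr => s sE.
have := subsetP EX _ sE; rewrite mem_simplices => /andP[sX /eqP <-].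
rewrite sum1_card -cards_draws -[RHS]cardsE; apply/eq_card=> t.
rewrite -[LHS]/(_ && _) !inE dimn_eq sE /=.
by have [ts|] := boolP (t \subset s); rewrite ?andbF // (complexS hX sX ts) andbT.
Qed.

Lemma card_diff_supersets E t :
  #|[set s :\: t | s in [set s in E | t \subset s]]| = #|[set s in E | t \subset s]|.
Proof.
apply: card_in_imset => s1 s2; rewrite !inE => /andP[_ t1] /andP[_ t2] E12.
by rewrite -(setID s1 t) -(setID s2 t) (setIidPr t1) (setIidPr t2) E12.
Qed.

Lemma setDUK s t : t \subset s -> (s :\: t) :|: t = s.
Proof. by move=> ts; rewrite setUC -{1}(setIidPr ts) setID. Qed.

Lemma setDI0 s t : (s :\: t) :&: t = set0.
Proof. by rewrite setIDAC setDIl setDv setI0. Qed.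

Lemma simplices_link t : t \in simplices X l%:Z ->
  simplices (link X t) r%:Z =
  [set s :\: t | s in [set s in simplices X k%:Z | t \subset s]].
Proof.
rewrite mem_simplices => /andP[tX /eqP ct]; apply/setP=> s.
apply/idP/imsetP=> [|[s']].
  rewrite inE mem_link // dimn_eq => /andP[/andP[stX st0] cs].
  exists (s :|: t).
    by rewrite !inE stX dimn_eq subsetUr andbT /= cardsUI0 // ct (eqP cs); lia.
  rewrite setDUl setDv setU0; apply/esym/setDidPl.
  by rewrite -setI_eq0.
rewrite !inE dimn_eq => /andP[/andP[sX /eqP cs] ts] ->.
rewrite setDUK // sX setDI0 eqxx dimn_eq (complexS hX sX (subsetDl _ _)) /=.
by rewrite cardsD (setIidPr ts) cs ct; lia.
Qed.

Lemma sum_fnum_link :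
  (\sum_(t in simplices X l%:Z) fnum (link X t) r%:Z =
   'C(k.+1, l.+1) * fnum X k%:Z)%N.
Proof.
rewrite -sum_card_supersets //; apply: eq_bigr => t tX.
by rewrite /fnum simplices_link // card_diff_supersets.
Qed.

Lemma contract_set_cycles t (z : chain K n) : t \in simplices X l%:Z ->
  z \in cycles K X k%:Z -> contract_set t z \in cycles K (link X t) r%:Z.
Proof.
move=> tX; rewrite !mem_cycles => /andP[/eqP z0 /mem_chains zX].
rewrite bdry_contract_set // eqxx /=; apply/mem_chains=> s.
rewrite contract_set_eq0 negb_or negbK => /andP[/eqP st0 /zX stX].
rewrite simplices_link //; apply/imsetP; exists (s :|: t).
  by rewrite inE stX subsetUr.
by rewrite setDUl setDv setU0; apply/esym/setDidPl; rewrite -setI_eq0 st0.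
Qed.

Lemma contract_set_diff_eq0 s t (z : chain K n) : t \subset s ->
  (contract_set t z (s :\: t) == 0) = (z s == 0).
Proof. by move=> ts; rewrite contract_set_eq0 setDI0 eqxx setDUK. Qed.

Lemma dual_system_link t E : t \in simplices X l%:Z ->
  dual_system (cycles K X k%:Z) E ->
  dual_system (cycles K (link X t) r%:Z)
    [set s :\: t | s in [set s in E | t \subset s]].
Proof.
move=> tX dE x /imsetP[s]; rewrite inE => /andP[sE ts] ->.
have [z zX zE] := dE _ sE; exists (contract_set t z).
  exact: contract_set_cycles.
move=> y /imsetP[s']; rewrite inE => /andP[s'E ts'] ->.
rewrite contract_set_diff_eq0 // zE //; apply/eqP/eqP=> [->//|E12].
by rewrite -(setDUK ts) -(setDUK ts') E12.
Qed.

Lemma dual_system_simplices E :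
  dual_system (cycles K X k%:Z) E -> E \subset simplices X k%:Z.
Proof.
move=> dE; apply/subsetP=> s sE; have [z] := dE _ sE.
by rewrite mem_cycles => /andP[_ /mem_chains zX] zE; apply: zX; rewrite zE.
Qed.

(** If z were supported on s alone, its boundary would have coefficient z s, up to sign, at a facet
    of s. *)
Lemma cycle_other_simplex (z : chain K n) s :
  z \in cycles K X k%:Z -> z s != 0 -> exists2 s', s' != s & z s' != 0.
Proof.
rewrite mem_cycles => /andP[/eqP z0 /mem_chains zX] zs.
have := zX _ zs; rewrite mem_simplices => /andP[_ /eqP cs].
have [v vs] : exists v, v \in s by apply/set0Pn; rewrite -card_gt0 cs.
apply/exists_inP; apply: contraNT zs => /exists_inPn z0'.
have := congr1 (fun c : chain K n => c (s :\ v)) z0.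
rewrite bdryE sum_ffunE (bigD1 v) //= ffunE !inE eqxx /= setD1K // big1.
  by rewrite addr0 ffunE => /eqP; rewrite mulf_eq0 signr_eq0.
move=> u uv; rewrite ffunE; case: ifP => // us; apply/eqP; rewrite mulf_eq0 signr_eq0.
apply/negPn/z0'; apply/eqP=> /setP/(_ v).
by rewrite !inE eqxx vs eq_sym (negPf uv).
Qed.

(* Basic cycles of [X] with respect to a dual system [E] contract to basic     *)
(* cycles of the links; a basic cycle has a face off its own simplex [s], and  *)
(* contracting by a simplex of that face not in [s] gives an additional        *)
(* independent cycle.                                                          *)
Lemma betti_lt_lambda :
  (forall t, t \in simplices X l%:Z ->
     betti K (link X t) r%:Z = \dim (cycles K (link X t) r%:Z)) ->
  \dim (cycles K X k%:Z) != 0%N ->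
  ('C(k.+1, l.+1) * \dim (cycles K X k%:Z) < lambda K l r%:Z X)%N.
Proof.
move=> bE; have [E dE <-] := exists_dual_system (cycles K X k%:Z).
rewrite -lt0n card_gt0 => /set0Pn[s sE].
have EX := dual_system_simplices dE.
have [z zX zE] := dE _ sE.
have [||s' s's zs'] := @cycle_other_simplex z s => //; first by rewrite zE.
have s'X : s' \in simplices X k%:Z.
  by move: zX; rewrite mem_cycles => /andP[_ /mem_chains]; apply.
have := subsetP EX _ sE; rewrite mem_simplices => /andP[_ /eqP cs].
have := s'X; rewrite mem_simplices => /andP[s'X' /eqP cs'].
have [v vs' vs] : exists2 v, v \in s' & v \notin s.
  by apply/subsetPn; apply: contra s's => ss; rewrite eqEcard ss cs cs' /=.
have [|t0 t0s ct0] := @exists_subset_card (s' :\ v) l.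
  by move: cs'; rewrite (cardsD1 v) vs'; lia.
have vt0 : v \notin t0 by apply: contraL isT => /(subsetP t0s); rewrite !inE eqxx.
pose t := v |: t0; have ts' : t \subset s'.
  by rewrite subUset sub1set vs' (subset_trans t0s) ?subsetDl.
have tX : t \in simplices X l%:Z.
  by rewrite mem_simplices (complexS hX s'X') // cardsU1 vt0 ct0 eqxx.
(* The sums are compared term by term, strictly at [t] and weakly elsewhere. *)
rewrite -sum_card_supersets // /lambda (bigD1 t) // [X in (_ < X)%N](bigD1 t) //=.
rewrite -addSn leq_add //; last first.
  apply: leq_sum => u /andP[uX _]; rewrite bE // -card_diff_supersets.
  exact/card_dual_system/dual_system_link.
rewrite bE // -card_diff_supersets.
apply: (@card_dual_system_lt _ _ _ _ (contract_set t z)).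
- exact: dual_system_link.
- exact: contract_set_cycles.
- apply: contraNneq zs' => w0.
  by rewrite -(contract_set_diff_eq0 _ ts') w0 ffunE.
(* Within E, z is nonzero only at s, and s does not contain t because v is not in s. *)
move=> y /imsetP[u]; rewrite inE => /andP[uE tu] ->; apply/eqP.
rewrite contract_set_diff_eq0 // -[_ == 0]negbK zE //; apply: contra vs => /eqP <-.
by apply: (subsetP tu); rewrite setU11.
Qed.

End Flags.

Section NearlyFullLink.
Variables (k l : nat) (X : {set {set 'I_n}}) (t : {set 'I_n}).
Hypotheses (hlk : (l < k)%N) (hX : is_complex X) (ct : #|t| = l.+1).
Local Notation r := (k - l - 1)%N.

Lemma skeleton_sub_link :
  skeleton (k%:Z - 1) (full_simplex [set: 'I_n]) \subset X ->
  skeleton (r%:Z - 1) (full_simplex (~: t)) \subset link X t.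
Proof.
move=> X1; apply/subsetP=> s; rewrite !inE -disjoints_subset -setI_eq0.
case/andP=> st0; rewrite st0 andbT /dimn => cs.
suff stX : s :|: t \in X by rewrite stX (complexS hX stX (subsetUl _ _)).
apply: (subsetP X1); rewrite !inE subsetT /dimn cardsUI0 // ct /=.
by move: #|s| cs => m; lia.
Qed.

Lemma link_sub_skeleton :
  X \subset skeleton k%:Z (full_simplex [set: 'I_n]) ->
  link X t \subset skeleton r%:Z (full_simplex (~: t)).
Proof.
move=> X2; apply/subsetP=> s; rewrite mem_link // => /andP[/(subsetP X2)].
rewrite !inE !dimn_le => /andP[_ cst] st0.
rewrite -disjoints_subset -setI_eq0 st0 /=.
by move: cst; rewrite cardsUI0 // ct; move: #|s| => m; lia.
Qed.

End NearlyFullLink.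
End Links.

(** * The counting formulas and the equivalence *)

Theorem theorem4 (K : fieldType) (n k l : nat) (X : {set {set 'I_n}})
  (hlk : (l < k)%N) (hkn : (k <= n)%N)
  (hX : is_complex X)
  (hX1 : skeleton (k%:Z - 1) (full_simplex [set: 'I_n]) \subset X)
  (hX2 : X \subset skeleton k%:Z (full_simplex [set: 'I_n]))
  (hlambda : lambda K l (k%:Z - l%:Z - 2) X = 0%N) :
  Fnum n k l = binomz n%:Z l.+1 * binomz (n%:Z - l%:Z - 2) (k - l - 1)
                 / binomz (k%:Z + 1) l.+1 /\
  [<-> (betti K X (k%:Z - 1))%:R = Bnum n k l;
       betti K X k%:Z = 0%N /\ (fnum X k%:Z)%:R = Fnum n k l;
       forall t : {set 'I_n}, t \in simplices (full_simplex [set: 'I_n]) l%:Z ->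
         hypertree K (k%:Z - l%:Z - 1) (~: t) (link X t)].
Proof.
have Cpos : 0 < 'C(k.+1, l.+1)%:R :> rat by rewrite ltr0n bin_gt0; lia.
have Ck : binomz (k%:Z + 1) l.+1 = 'C(k.+1, l.+1)%:R.
  by rewrite -binomz_nat; congr binomz; lia.
have FE : Fnum n k l = binomz n%:Z l.+1 * binomz (n%:Z - l%:Z - 2) (k - l - 1)
    / binomz (k%:Z + 1) l.+1.
  rewrite /Fnum /Bnum; apply: (canRL (mulfK _)); first by rewrite Ck lt0r_neq0.
  rewrite mulrBl divfK ?binomz_Bnum_Fnum //; first by ring.
  by rewrite Ck lt0r_neq0.
split=> //.
pose r := (k - l - 1)%N.
have r1E : k%:Z - l%:Z - 1 = r%:Z by rewrite /r; lia.
have r2E : k%:Z - l%:Z - 2 = r%:Z - 1 by rewrite /r; lia.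
rewrite r1E; rewrite r2E in hlambda.
(* As l < k, the full skeleton puts every set of l + 1 vertices in X, so L runs over all of them. *)
have XT t : (t \in simplices X l%:Z) = (#|t| == l.+1).
  rewrite mem_simplices; have [ct|] := eqVneq #|t| l.+1; rewrite ?andbF // andbT.
  by apply: (subsetP hX1); rewrite !inE subsetT /dimn ct; lia.
have fullT t : (t \in simplices (full_simplex [set: 'I_n]) l%:Z) = (#|t| == l.+1).
  by rewrite mem_simplices powersetE subsetT.
have linkP (t : {set 'I_n}) : #|t| = l.+1 -> [/\ is_complex (link X t),
    skeleton (r%:Z - 1) (full_simplex (~: t)) \subset link X t &
    link X t \subset skeleton r%:Z (full_simplex (~: t))].
  move=> ct; split; [|exact: skeleton_sub_link|exact: link_sub_skeleton].
  by apply: is_complex_link => //; have := XT t; rewrite ct eqxx inE => /andP[].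
have ctC (t : {set 'I_n}) : #|t| = l.+1 -> (#|~: t| + l.+1 = n)%N.
  by move=> ct; rewrite -ct addnC cardsC card_ord.
have b1 (t : {set 'I_n}) : #|t| = l.+1 -> betti K (link X t) (r%:Z - 1) = 0%N.
  move=> ct; apply/eqP; have /eqP := hlambda; rewrite sum_nat_eq0.
  by move/forall_inP; apply; rewrite XT ct.
have Cn : #|simplices X l%:Z| = 'C(n, l.+1).
  rewrite -[in RHS](card_ord n) -card_draws; apply: eq_card => t.
  by rewrite XT inE.
have eulerX : (betti K X k%:Z)%:R + binomz (n%:Z - 1) k =
    (fnum X k%:Z)%:R + (betti K X (k%:Z - 1))%:R.
  by have := euler_nearly_full K hX hX1 hX2; rewrite cardsT card_ord; apply.
have eulerL (t : {set 'I_n}) : #|t| = l.+1 ->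
    (betti K (link X t) r%:Z)%:R + binomz (n%:Z - l%:Z - 2) r =
    (fnum (link X t) r%:Z)%:R.
  move=> ct; have [h0 h1 h2] := linkP _ ct; have := ctC _ ct => E.
  have := euler_nearly_full K h0 h1 h2; rewrite b1 // addr0.
  have -> : n%:Z - l%:Z - 2 = #|~: t|%:Z - 1 by move: E; move: #|~: t| => m; lia.
  by apply; move: E; rewrite /r; move: #|~: t| => m; lia.
have sumE : (lambda K l r%:Z X)%:R + 'C(n, l.+1)%:R * binomz (n%:Z - l%:Z - 2) r =
    'C(k.+1, l.+1)%:R * (fnum X k%:Z)%:R.
  rewrite -natrM -(sum_fnum_link hlk hX) /lambda !natr_sum -Cn mulr_natl -sumr_const.
  by rewrite -big_split; apply: eq_bigr => t; rewrite XT => /eqP /eulerL.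
have fE : (fnum X k%:Z)%:R = Fnum n k l + (lambda K l r%:Z X)%:R / 'C(k.+1, l.+1)%:R.
  rewrite FE Ck binomz_nat -/r -mulrDl; apply: (canRL (mulfK _)).
    by rewrite lt0r_neq0.
  by rewrite mulrC -sumE addrC.
have bE : (betti K X (k%:Z - 1))%:R = (betti K X k%:Z)%:R + Bnum n k l
    - (lambda K l r%:Z X)%:R / 'C(k.+1, l.+1)%:R.
  by move: eulerX; rewrite fE /Fnum => e; apply/(canRL (addrK _)); lra.
have ltL : betti K X k%:Z != 0%N ->
    ('C(k.+1, l.+1) * betti K X k%:Z < lambda K l r%:Z X)%N.
  rewrite (bettiE_top K hX hX2); apply: betti_lt_lambda => // t.
  by rewrite XT => /eqP /linkP[h0 _ h2]; exact: bettiE_top h0 h2.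
have treeP (t : {set 'I_n}) : #|t| = l.+1 ->
    hypertree K r%:Z (~: t) (link X t) <-> betti K (link X t) r%:Z = 0%N.
  move=> ct; have [h0 h1 h2] := linkP _ ct.
  rewrite (hypertree_nearly_full K h0 h1 h2) ?b1 //; first by split=> [[]|].
  by rewrite -card_gt0; have := ctC _ ct; rewrite /r; move: #|~: t| => m; lia.
have lambdaP : lambda K l r%:Z X = 0%N <->
    forall t : {set 'I_n}, #|t| = l.+1 -> hypertree K r%:Z (~: t) (link X t).
  split=> [/eqP|H].
    rewrite sum_nat_eq0 => /forall_inP H t ct; apply/treeP => //; apply/eqP/H.
    by rewrite XT ct.
  by apply: big1 => t; rewrite XT => /eqP ct; apply/treeP/H.
tfae.
(* Condition (a) turns [bE] into C * b_k = L, which contradicts [ltL] unless b_k = 0. *)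
- move=> b; rewrite b in bE.
  have e : (betti K X k%:Z)%:R = (lambda K l r%:Z X)%:R / 'C(k.+1, l.+1)%:R :> rat by lra.
  have b0 : betti K X k%:Z = 0%N.
    apply/eqP; apply: contraT => /ltL; rewrite -(ltr_nat rat) natrM e.
    by rewrite mulrC divfK ?lt0r_neq0 // ltxx.
  by split=> //; rewrite fE -e b0 addr0.
- case=> _ f t; rewrite fullT => /eqP; apply: (lambdaP.1 _ t).
  have : (lambda K l r%:Z X)%:R / 'C(k.+1, l.+1)%:R = 0 :> rat by move: fE; rewrite f; lra.
  by move/eqP; rewrite mulf_eq0 invr_eq0 (gt_eqF Cpos) orbF pnatr_eq0 => /eqP.
- move=> H; have L0 : lambda K l r%:Z X = 0%N.
    by apply/lambdaP => t ct; apply: H; rewrite fullT ct.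
  have b0 : betti K X k%:Z = 0%N by apply/eqP; apply: contraT => /ltL; rewrite L0.
  by rewrite bE L0 b0 mul0r subr0 add0r.
Qed.
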